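(* For each integer $n\geq 2$ let $A_n=C(PU(n),\mathbb{M}_n)$ be the $C^*$-algebra of continuous functions from $PU(n)$ to $\mathbb{M}_n$. Then every derivation of $A_n$ is inner, but $A_n$ admits an outer automorphism that is also an elementary operator on $A_n$.
   Context: $PU(n)=U(n)/\mathbb{S}^1$ is the projective unitary group with its usual compact topology, and $\mathbb{M}_n$ is the algebra of $n\times n$ complex matrices. A derivation $\delta$ of a unital $C^*$-algebra $A$ (a linear map $\delta:A\to A$ with $\delta(xy)=\delta(x)y+x\delta(y)$) is inner if there is $a\in A$ with $\delta(x)=ax-xa$ for all $x\in A$. An automorphism of a unital $C^*$-algebra $A$ is inner if it is of the form $x\mapsto axa^{-1}$ for some invertible $a\in A$, and outer otherwise. An elementary operator on a unital $C^*$-algebra $A$ is a map $A\to A$ that is a finite sum of maps $x\mapsto axb$ with $a,b\in A$. *)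

(* Defs.v *)
From HB Require Import structures.
From mathcomp Require Import all_boot all_order all_algebra spectral sesquilinear.
From mathcomp Require Import complex.
From mathcomp Require Import all_classical all_reals all_analysis.

Set Implicit Arguments.
Unset Strict Implicit.
Unset Printing Implicit Defensive.

Import Order.TTheory GRing.Theory Num.Theory numFieldNormedType.Exports.

Local Open Scope classical_set_scope.
Local Open Scope ring_scope.
Local Open Scope sesquilinear_scope.
Local Open Scope quotient_scope.

(* The definitions below are over a generic [C : numClosedFieldType], on which
   the norm topology is canonical. The field of complex numbers is
   [C := R[i]] with [R : realType]. *)

Section ProjectiveUnitaryGroup.
Variables (C : numClosedFieldType) (n : nat).

(* As a [set_type], U(n) carries the topology induced by 'M[C]_n. *)
Definition unitary_group : set 'M[C]_n := [set u | u \is unitarymx].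

Definition phase_eq (u v : unitary_group) : bool :=
  `[< exists2 z : C, `|z| = 1 & \val v = z *: \val u >].

Lemma phase_eq_refl : reflexive phase_eq.
Proof. by move=> u; apply/asboolP; exists 1; rewrite ?normr1 ?scale1r. Qed.

Lemma phase_eq_sym : symmetric phase_eq.
Proof.
suff H u v : phase_eq u v -> phase_eq v u by move=> u v; apply/idP/idP; exact: H.
move=> /asboolP[z z1 uv]; apply/asboolP; exists z^-1.
  by rewrite normfV z1 invr1.
rewrite uv scalerA mulVf ?scale1r// -normr_eq0 z1; exact: oner_neq0.
Qed.

Lemma phase_eq_trans : transitive phase_eq.
Proof.
move=> v u w /asboolP[z z1 uv] /asboolP[y y1 vw]; apply/asboolP; exists (y * z).
  by rewrite normrM y1 z1 mulr1.
by rewrite vw uv scalerA.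
Qed.

Canonical phase_equiv : equiv_rel unitary_group :=
  EquivRel phase_eq phase_eq_refl phase_eq_sym phase_eq_trans.

(* PU(n) = U(n) / S^1, with the quotient topology. *)
Definition PU : topologicalType :=
  quotient_topology {eq_quot phase_equiv}.

End ProjectiveUnitaryGroup.

Arguments unitary_group : clear implicits.
Arguments phase_equiv : clear implicits.

Section ContinuousMatrixFunctions.
Variables (X : topologicalType) (C : numClosedFieldType) (n : nat).

(* The algebra C(X, M_n), with pointwise operations. *)
Definition cmx : Type := continuousType X 'M[C]_n.

HB.instance Definition _ := Choice.copy cmx (continuousType X 'M[C]_n).

Definition mkcmx (f : X -> 'M[C]_n) (cf : continuous f) : cmx := mkcts cf.

Lemma cmxP (f g : cmx) : f =1 g -> f = g.
Proof. by move=> fg; apply/continuousEP. Qed.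

Lemma continuous_entries (f : X -> 'M[C]_n) :
  (forall i j, continuous (fun x => f x i j)) -> continuous f.
Proof.
move=> cf x A [P fP PA]; rewrite /nbhs/=.
have : \forall y \near x, forall i j, P i j (f y i j).
  by apply: filter_forall => i; apply: filter_forall => j; exact: cf (fP i j).
by apply: filterS => y fy; exact: PA.
Qed.

Lemma continuous_entry (f : cmx) i j : continuous (fun x => f x i j).
Proof.
move=> x; apply: (@continuous_comp _ _ _ f (fun M : 'M[C]_n => M i j)).
  exact: cts_fun.
exact: coord_continuous.
Qed.

Lemma cmx_add_subproof (f g : cmx) : continuous (fun x => f x + g x).
Proof. by move=> x; apply: cvgD; exact: cts_fun. Qed.

Lemma cmx_opp_subproof (f : cmx) : continuous (fun x => - f x).
Proof. by move=> x; apply: cvgN; exact: cts_fun. Qed.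

Lemma cmx_cst_subproof (M : 'M[C]_n) : continuous (fun _ : X => M).
Proof. by move=> x; exact: cvg_cst. Qed.

Lemma cmx_mul_subproof (f g : cmx) : continuous (fun x => f x *m g x).
Proof.
apply: continuous_entries => i j x.
rewrite (_ : (fun y => _) = (fun y => \sum_k f y i k * g y k j)); last first.
  by apply/funext => y; rewrite mxE.
elim: (index_enum _) => [|k r IH].
  by under eq_fun do rewrite big_nil; exact: cvg_cst.
under eq_fun do rewrite big_cons.
apply: cvgD; last exact: IH.
by apply: cvgM; exact: continuous_entry.
Qed.

Lemma cmx_scale_subproof (a : C) (f : cmx) : continuous (fun x => a *: f x).
Proof. by move=> x; apply: cvgZr; exact: cts_fun. Qed.

Lemma cmx_star_subproof (f : cmx) : continuous (fun x => (f x)^t*).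
Proof.
apply: continuous_entries => i j x.
rewrite (_ : (fun y => _) = (fun y => (f y j i)^*)); last first.
  by apply/funext => y; rewrite !mxE.
apply/(@cvgrPdist_lt C C^o) => e e0; near=> y.
rewrite -rmorphB norm_conjC.
near: y; move: e e0; apply/(@cvgrPdist_lt C C^o); exact: continuous_entry.
Unshelve. all: by end_near. Qed.

Definition cmx_zero : cmx := mkcmx (@cmx_cst_subproof 0).
Definition cmx_one : cmx := mkcmx (@cmx_cst_subproof 1%:M).
Definition cmx_add (f g : cmx) : cmx := mkcmx (@cmx_add_subproof f g).
Definition cmx_opp (f : cmx) : cmx := mkcmx (@cmx_opp_subproof f).
Definition cmx_mul (f g : cmx) : cmx := mkcmx (@cmx_mul_subproof f g).
Definition cmx_scale (a : C) (f : cmx) : cmx := mkcmx (@cmx_scale_subproof a f).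

Definition cmx_star (f : cmx) : cmx := mkcmx (@cmx_star_subproof f).

Program Definition cmx_isZmodule := @GRing.isZmodule.Build cmx
  cmx_zero cmx_opp cmx_add _ _ _ _.
Next Obligation. by move=> f g h; apply: cmxP => x; exact: addrA. Qed.
Next Obligation. by move=> f g; apply: cmxP => x; exact: addrC. Qed.
Next Obligation. by move=> f; apply: cmxP => x; exact: add0r. Qed.
Next Obligation. by move=> f; apply: cmxP => x; exact: addNr. Qed.
HB.instance Definition _ := cmx_isZmodule.

Program Definition cmx_isPzRing := @GRing.Zmodule_isPzRing.Build cmx
  cmx_one cmx_mul _ _ _ _ _.
Next Obligation. by move=> f g h; apply: cmxP => x; exact: mulmxA. Qed.
Next Obligation. by move=> f; apply: cmxP => x; exact: mul1mx. Qed.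
Next Obligation. by move=> f; apply: cmxP => x; exact: mulmx1. Qed.
Next Obligation. by move=> f g h; apply: cmxP => x; exact: mulmxDl. Qed.
Next Obligation. by move=> f g h; apply: cmxP => x; exact: mulmxDr. Qed.
HB.instance Definition _ := cmx_isPzRing.

Program Definition cmx_isLmodule := @GRing.Zmodule_isLmodule.Build C cmx
  cmx_scale _ _ _ _.
Next Obligation. by move=> a b f; apply: cmxP => x; exact: scalerA. Qed.
Next Obligation. by move=> f; apply: cmxP => x; exact: scale1r. Qed.
Next Obligation. by move=> a f g; apply: cmxP => x; exact: scalerDr. Qed.
Next Obligation. by move=> f a b; apply: cmxP => x; exact: scalerDl. Qed.
HB.instance Definition _ := cmx_isLmodule.

End ContinuousMatrixFunctions.

Section Operators.
Variable A : pzRingType.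
Implicit Types phi delta : A -> A.

Definition inner_derivation delta : Prop :=
  exists a, forall x, delta x = a * x - x * a.

Definition inner_automorphism phi : Prop :=
  exists a b, [/\ a * b = 1, b * a = 1 & forall x, phi x = a * x * b].

Definition elementary_operator phi : Prop :=
  exists s : seq (A * A), forall x, phi x = \sum_(p <- s) p.1 * x * p.2.

End Operators.

Section StarAlgebraMaps.
Variables (X : topologicalType) (C : numClosedFieldType) (n : nat).
Implicit Types phi delta : cmx X C n -> cmx X C n.

Definition derivation delta : Prop :=
  linear delta /\ forall x y, delta (x * y) = delta x * y + x * delta y.

(* Automorphisms are those of C*-algebras, i.e. they preserve the involution;
   [inner_automorphism] allows an arbitrary invertible element, not only a
   unitary one. *)
Definition star_automorphism phi : Prop :=
  [/\ bijective phi, linear phi, monoid_morphism phi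
    & {morph phi : f / cmx_star f}].

End StarAlgebraMaps.

(* Main.v *)
Require Import Defs.
From mathcomp Require Import all_boot all_order all_algebra complex.
From mathcomp Require Import spectral sesquilinear.
From mathcomp Require Import ring lra.
From mathcomp Require Import all_classical all_reals all_analysis.
Import Order.TTheory GRing.Theory Num.Theory numFieldNormedType.Exports.

Set Implicit Arguments.
Unset Strict Implicit.
Unset Printing Implicit Defensive.

Local Open Scope classical_set_scope.
Local Open Scope ring_scope.

(** Write [A] for the algebra of continuous maps from [PU(n)] to matrices.

    Derivations.  Over any space [X], a derivation [delta] kills a scalar
    function [c] at every point [x]: the function [c - c x] is a product of two
    continuous functions vanishing at [x], namely [d / sqrt|d|] and [sqrt|d|]
    with [d = c - c x], so the Leibniz rule gives [0] at [x]
    ([derivation_scalar]).  Hence [delta] is determined by its values on the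
    constant matrix units [E i j], and there it is the commutator with
    [a = sum_i delta(E i i0) E i0 i], by the same computation that shows that
    derivations of a matrix algebra are inner ([derivation_inner]).

    The automorphism.  Take [phi f x = u (f x) u^-1] where [x] is the class of
    [u]; this is independent of the phase of [u].  The matrix [u M u^-1] is the
    sum of the [M i j (u (E i j) u^-1)], where the scalar [M i j] can be written
    [sum_k E k i M E j k] and [u (E i j) u^-1] is an element of [A].  So [phi]
    is an elementary operator ([sandwichE], [sandwich_elementary]).

    Outerness.  If [phi f = a f a^-1], then [u^-1 a] commutes with all
    matrices, so it is a scalar [l u]: a continuous nowhere zero function on
    [U(n)] with [l (z u) = z^-1 (l u)] for every phase [z]
    ([inner_conj_rep_phase]).  The fundamental group forbids this.  The loop
    [s |-> e^(2 pi i s) 1] is homotopic in [U(n)] to the [n]-th power of the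
    loop [s |-> diag(e^(2 pi i s), 1, ..., 1)]: write the first one as the
    product over [k] of the loops of complex reflections
    [1 + (e^(2 pi i s) - 1) E k k] and tilt all axes towards a common one
    ([loop_homotopy]).  Along the first loop [l] has winding number [-1], along
    the second one its winding number is divisible by [n >= 2], a contradiction
    ([winding_obstruction]).

    Winding numbers are computed without lifting paths: on a fine enough
    subdivision of the unit interval the successive quotients of the values of
    a loop have positive real part, so the winding number is [1 / (2 pi)] times
    the sum of their principal arguments.  By compactness one subdivision
    serves all loops of a homotopy, the sum is then continuous in the homotopy
    parameter and takes its values in a discrete set. *)

(** * Derivations *)

Section SquareRoot.
Variable C : numClosedFieldType.

Lemma sqrtC_dist (a b : C) : 0 <= a -> 0 <= b ->
  `|sqrtC a - sqrtC b| <= sqrtC `|a - b|.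
Proof.
move=> a0 b0.
rewrite -(@ler_pXn2r _ 2) ?nnegrE ?sqrtC_ge0 ?normr_ge0// sqrtCK.
rewrite -{2}(sqrtCK a) -{2}(sqrtCK b) subr_sqr normrM expr2.
apply: ler_wpM2l; first exact: normr_ge0.
rewrite [leRHS]ger0_norm ?addr_ge0 ?sqrtC_ge0//.
by rewrite (le_trans (ler_normB _ _))// !ger0_norm ?sqrtC_ge0.
Qed.

Lemma continuous_sqrtC_norm (X : topologicalType) (c : X -> C) :
  continuous c -> continuous (fun x => sqrtC `|c x|).
Proof.
move=> cc x; apply/(@cvgrPdist_lt C C^o) => e e0.
have e20 : 0 < e ^+ 2 by rewrite exprn_gt0.
have /(@cvgrPdist_lt C C^o) /(_ _ e20) := cc x.
apply: filterS => y cxy.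
apply: le_lt_trans (sqrtC_dist _ _) _; rewrite ?normr_ge0//.
rewrite -(@ltr_pXn2r _ 2) ?nnegrE ?sqrtC_ge0 ?normr_ge0 ?ltW// sqrtCK.
exact: le_lt_trans (ler_dist_dist _ _) cxy.
Qed.

(** Where [c] vanishes the quotient is [0 / 0 = 0]; it is continuous there
    because its norm is [sqrtC `|c|]. *)
Lemma continuous_div_sqrtC_norm (X : topologicalType) (c : X -> C) :
  continuous c -> continuous (fun x => c x / sqrtC `|c x|).
Proof.
move=> cc x; have [cx0|cx0] := eqVneq (c x) 0; last first.
  apply: cvgM; first exact: cc.
  apply: cvgV; last exact: continuous_sqrtC_norm.
  by rewrite sqrtC_eq0 normr_eq0.
apply/(@cvgrPdist_lt C C^o) => e e0.
have /(@cvgrPdist_lt C C^o) /(_ _ e0) := @continuous_sqrtC_norm X c cc x.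
rewrite cx0 normr0 sqrtC0 invr0 mulr0.
apply: filterS => y; rewrite !sub0r !normrN => h.
suff -> : `|c y / sqrtC `|c y| | = `|sqrtC `|c y| | by [].
rewrite normrM normfV (ger0_norm (x := sqrtC _)) ?sqrtC_ge0 ?normr_ge0//.
have [->|cy0] := eqVneq (c y) 0; first by rewrite normr0 mul0r sqrtC0.
apply: (mulIf (x := sqrtC `|c y|)); first by rewrite sqrtC_eq0 normr_eq0.
by rewrite mulfVK ?sqrtC_eq0 ?normr_eq0// -expr2 sqrtCK.
Qed.

End SquareRoot.

Section Derivations.
Variables (X : topologicalType) (C : numClosedFieldType) (n : nat).
Local Notation A := (cmx X C n).

Definition cmx_const (M : 'M[C]_n) : A := mkcmx (@cmx_cst_subproof X C n M).

Lemma continuous_scalar_mx (c : X -> C) :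
  continuous c -> continuous (fun x => (c x)%:M : 'M[C]_n).
Proof.
move=> cc; apply: continuous_entries => i j x.
under eq_fun do rewrite mxE.
case: (i == j); first exact: cc.
by under eq_fun do rewrite mulr0n; exact: cvg_cst.
Qed.

Definition cmx_scalar (c : X -> C) (cc : continuous c) : A :=
  mkcmx (continuous_scalar_mx cc).

Lemma cmxME (f g : A) x : (f * g) x = f x *m g x. Proof. by []. Qed.
Lemma cmxDE (f g : A) x : (f + g) x = f x + g x. Proof. by []. Qed.
Lemma cmxZE a (f : A) x : (a *: f) x = a *: f x. Proof. by []. Qed.
Lemma cmx1E x : (1 : A) x = 1%:M. Proof. by []. Qed.
Lemma cmx_constE M x : cmx_const M x = M. Proof. by []. Qed.
Lemma cmx_scalarE c (cc : continuous c) x : cmx_scalar cc x = (c x)%:M.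
Proof. by []. Qed.
Lemma cmx_sumE I (r : seq I) (P : pred I) (F : I -> A) x :
  (\sum_(i <- r | P i) F i) x = \sum_(i <- r | P i) F i x.
Proof.
by elim/big_rec2 : _ => // i M f _ <-.
Qed.

(** [A] is generated by scalar functions and constant matrix units. *)
Lemma cmx_expand (f : A) :
  f = \sum_i \sum_j
    cmx_scalar (@continuous_entry _ _ _ f i j) * cmx_const (delta_mx i j).
Proof.
apply: cmxP => x; rewrite cmx_sumE {1}(matrix_sum_delta (f x)).
apply: eq_bigr => i _; rewrite cmx_sumE; apply: eq_bigr => j _.
by rewrite cmxME /= mul_scalar_mx.
Qed.

Variable delta : A -> A.
Hypothesis der : derivation delta.

Let deltaD f g : delta (f + g) = delta f + delta g.
Proof. by have [/(_ 1 f g) + _] := der; rewrite !scale1r. Qed.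

Let delta0 : delta 0 = 0.
Proof. by apply: (addrI (delta 0)); rewrite -deltaD !addr0. Qed.

Let delta_sum I (r : seq I) (F : I -> A) :
  delta (\sum_(i <- r) F i) = \sum_(i <- r) delta (F i).
Proof. by rewrite (big_morph delta deltaD delta0). Qed.

Let deltaM f g : delta (f * g) = delta f * g + f * delta g.
Proof. by have [_] := der. Qed.

Let deltaZ a f : delta (a *: f) = a *: delta f.
Proof. by have [/(_ a f 0) + _] := der; rewrite !addr0 delta0 addr0. Qed.

Let delta1 : delta 1 = 0.
Proof.
by apply: (addrI (delta 1)); rewrite addr0 -{3}(mulr1 1) deltaM mulr1 mul1r.
Qed.

(** The ideal of functions vanishing at [x] equals its own square, so a
    derivation sends it to functions vanishing at [x]. *)
Lemma derivation_scalar (c : X -> C) (cc : continuous c) :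
  delta (cmx_scalar cc) = 0.
Proof.
apply: cmxP => x.
pose d y := c y - c x.
have cd : continuous d by move=> y; apply: cvgB; [exact: cc|exact: cvg_cst].
pose p := cmx_scalar (continuous_div_sqrtC_norm cd).
pose q := cmx_scalar (continuous_sqrtC_norm cd).
have -> : cmx_scalar cc = p * q + c x *: (1 : A).
  apply: cmxP => y; rewrite cmxDE cmxME cmxZE /=.
  rewrite -scalar_mxM scalemx1 -raddfD /=; congr (_%:M).
  have [dy0|dy0] := eqVneq (d y) 0.
    by rewrite dy0 !mul0r add0r; apply/eqP; rewrite -subr_eq0 -/(d y) dy0.
  by rewrite mulfVK ?sqrtC_eq0 ?normr_eq0// subrK.
rewrite deltaD deltaZ delta1 scaler0 addr0 deltaM cmxDE !cmxME !cmx_scalarE.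
have dx0 : d x = 0 by rewrite /d subrr.
by rewrite dx0 normr0 sqrtC0 mul0r mul_mx_scalar mul_scalar_mx !scale0r addr0.
Qed.

Lemma derivation_inner (i0 : 'I_n) : inner_derivation delta.
Proof.
pose E i j := cmx_const (delta_mx i j).
have EM i j k l : E i j * E k l = (E i l) *+ (j == k).
  apply: cmxP => x; rewrite cmxME /= mul_delta_mx_cond.
  by case: (j == k).
have E1 : \sum_i E i i = 1.
  apply: cmxP => x; rewrite cmx_sumE /=.
  rewrite [RHS](matrix_sum_delta (1%:M : 'M[C]_n)); apply: eq_bigr => i _.
  rewrite (bigD1 i)//= big1 => [|j ji]; first by rewrite mxE eqxx scale1r addr0.
  by rewrite mxE eq_sym (negPf ji) scale0r.
(* If [delta] is the commutator with [b], this sum is [b] minus the scalar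
   function [b i0 i0], so it is the only candidate up to scalar functions. *)
pose a := \sum_i delta (E i i0) * E i0 i; exists a.
have aE j k : delta (E j k) = a * E j k - E j k * a.
  rewrite mulr_suml mulr_sumr (bigD1 j)//= [X in _ + X - _]big1 => [|i ij].
    2: by rewrite -mulrA EM (negPf ij) mulr0.
  rewrite addr0 -(mulrA _ (E i0 j)) EM eqxx mulr1n.
  (* In the first half of the subtracted sum only [i = k] survives, the
     second half is [delta (E j k)] times the unit. *)
  transitivity (delta (E j i0) * E i0 k -
    \sum_i (delta (E j k * E i i0) - delta (E j k) * E i i0) * E i0 i).
    under eq_bigr => i _ do
      rewrite mulrBl -(mulrA _ (E i i0)) (EM i i0) eqxx mulr1n.
    rewrite sumrB -mulr_sumr E1 mulr1 opprB addrCA.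
    rewrite [X in _ + X](_ : _ = 0) ?addr0//.
    apply/eqP; rewrite subr_eq0 eq_sym (bigD1 k)//= EM eqxx mulr1n.
    rewrite big1 ?addr0// => i ik; rewrite EM eq_sym (negPf ik) delta0.
    exact: mul0r.
  congr (_ - _); apply: eq_bigr => i _.
  by rewrite deltaM [X in X - _]addrC addrK mulrA.
move=> f; rewrite [in RHS](cmx_expand f) [in LHS](cmx_expand f) delta_sum.
rewrite mulr_sumr mulr_suml -sumrB; apply: eq_bigr => i _.
rewrite delta_sum mulr_sumr mulr_suml -sumrB; apply: eq_bigr => j _.
rewrite deltaM derivation_scalar mul0r add0r -/(E i j) aE mulrBr !mulrA.
congr (_ * _ - _); apply: cmxP => x; rewrite !cmxME /=.
by rewrite scalar_mxC.
Qed.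

End Derivations.

(** * Conjugation by unitaries, as an elementary operator *)

Section ConjugationOperator.
Variables (X : topologicalType) (C : numClosedFieldType) (n : nat).
Local Notation A := (cmx X C n).

(** An elementary operator that extracts one entry of [M] as a scalar matrix:
    matrix algebras are central simple. *)
Lemma sum_delta_sandwich (M : 'M[C]_n) i j :
  \sum_k delta_mx k i *m M *m delta_mx j k = (M i j)%:M :> 'M[C]_n.
Proof.
apply/matrixP => k l; rewrite summxE (bigD1 k)//= big1 ?addr0 => [|m mk].
  rewrite !mxE (bigD1 j)//= big1 ?addr0 => [|m mj].
    rewrite !mxE (bigD1 i)//= big1 ?addr0 => [|m mi]; last first.
      by rewrite !mxE (negPf mi) andbF mul0r.
    by rewrite !mxE !eqxx mul1r eq_sym mulr_natr.
  by rewrite !mxE (negPf mj) mulr0.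
rewrite !mxE big1// => j' _; rewrite !mxE big1 ?mul0r// => i' _.
by rewrite !mxE eq_sym (negPf mk) mul0r.
Qed.

Variables g h : X -> 'M[C]_n.
Hypothesis cgh : forall M, continuous (fun x => g x *m M *m h x).

(** The indices [t = (i, (j, k))] give the terms
    [g (E i j) h * E k i * f * E j k].  Only the maps [g (E i j) h] have to be
    continuous: in the application [g] and [h] are not. *)
Definition sandwich (f : A) : A :=
  \sum_(t : 'I_n * ('I_n * 'I_n))
    (mkcmx (@cgh (delta_mx t.1 t.2.1)) * cmx_const _ (delta_mx t.2.2 t.1))
    * f * cmx_const _ (delta_mx t.2.1 t.2.2).

Lemma sandwich_elementary : elementary_operator sandwich.
Proof.
exists [seq (mkcmx (@cgh (delta_mx t.1 t.2.1))
               * cmx_const _ (delta_mx t.2.2 t.1),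
             cmx_const X (delta_mx t.2.1 t.2.2))
       | t : 'I_n * ('I_n * 'I_n)].
by move=> f; rewrite /image_mem big_map big_enum.
Qed.

Lemma sandwichE f x : sandwich f x = g x *m f x *m h x.
Proof.
rewrite /sandwich cmx_sumE.
pose F i j k := g x *m delta_mx i j *m h x
  *m (delta_mx k i *m f x *m delta_mx j k).
transitivity (\sum_i \sum_j \sum_k F i j k).
  under [RHS]eq_bigr do rewrite pair_bigA.
  rewrite pair_bigA; apply: eq_bigr => -[i [j k]] _.
  by rewrite !cmxME !cmx_constE /F !mulmxA.
rewrite [in RHS](matrix_sum_delta (f x)) mulmx_sumr mulmx_suml.
apply: eq_bigr => i _; rewrite mulmx_sumr mulmx_suml.
apply: eq_bigr => j _; rewrite -mulmx_sumr sum_delta_sandwich.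
by rewrite mul_mx_scalar -scalemxAr -scalemxAl.
Qed.

End ConjugationOperator.

Section RepresentativeConjugation.
Variables (C : numClosedFieldType) (n : nat).
Local Notation U := (unitary_group C n).
Local Notation PU := (PU C n).
Local Notation A := (cmx PU C n).
Local Open Scope quotient_scope.
Local Open Scope sesquilinear_scope.

Definition pu (u : U) : PU := \pi_{eq_quot phase_equiv C n} u.
(** A representative of [x] in [U(n)], in general discontinuous in [x]. *)
Definition rep (x : PU) : 'M[C]_n := \val (repr x).

Lemma unitary_mulVmx (u : 'M[C]_n) : u \is unitarymx -> u^t* *m u = 1%:M.
Proof. by move=> /unitarymxP/mulmx1C. Qed.

Lemma val_unitary (u : U) : \val u \is unitarymx.
Proof. by have := valP u; rewrite inE. Qed.

Lemma rep_unitary x : rep x \is unitarymx.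
Proof. exact: val_unitary. Qed.

Lemma rep_pu u : exists2 z : C, `|z| = 1 & rep (pu u) = z *: \val u.
Proof.
have : pu u = pu (repr (pu u)) by rewrite /pu reprK.
by move=> /eqmodP/asboolP.
Qed.

Lemma continuous_pu : continuous pu.
Proof. exact: pi_continuous. Qed.

Lemma continuous_PU (Z : topologicalType) (f : PU -> Z) :
  continuous (f \o pu) -> continuous f.
Proof. by move=> cf; apply/quotient_continuous. Qed.

Lemma continuous_unitary_val : continuous (\val : U -> 'M[C]_n).
Proof. exact: initial_continuous. Qed.

Lemma adjmxZ (z : C) (u : 'M[C]_n) : (z *: u)^t* = z^* *: u^t*.
Proof. by apply/matrixP => i j; rewrite !mxE rmorphM. Qed.

Lemma adjmxM (u v : 'M[C]_n) : (u *m v)^t* = v^t* *m u^t*.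
Proof. by rewrite trmx_mul map_mxM. Qed.

Lemma adjmxK (u : 'M[C]_n) : (u^t*)^t* = u.
Proof. by apply/matrixP => i j; rewrite !mxE; exact: conjCK. Qed.

Lemma mx_commutant (i0 : 'I_n) (S : 'M[C]_n) :
  (forall M, S *m M = M *m S) -> S = (S i0 i0)%:M.
Proof.
move=> SM; apply/matrixP => i j.
have /matrixP /(_ i i0) := SM (delta_mx j i0).
rewrite !mxE (bigD1 j)//= big1 ?addr0 => [|k kj]; last first.
  by rewrite !mxE (negPf kj) mulr0.
rewrite (bigD1 i0)//= big1 ?addr0 => [|k ki0]; last first.
  by rewrite !mxE (negPf ki0) andbF mul0r.
rewrite !mxE !eqxx mulr1 => ->.
by rewrite andbT mulr_natl.
Qed.

Lemma conj_phase (z : C) (u M : 'M[C]_n) : `|z| = 1 ->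
  (z *: u) *m M *m (z *: u)^t* = u *m M *m u^t*.
Proof.
move=> z1; rewrite adjmxZ -!scalemxAl -scalemxAr scalerA.
by rewrite -normCK z1 expr1n scale1r.
Qed.

Lemma conj_phaseV (z : C) (u M : 'M[C]_n) : `|z| = 1 ->
  (z *: u)^t* *m M *m (z *: u) = u^t* *m M *m u.
Proof.
move=> z1; rewrite adjmxZ -!scalemxAl -scalemxAr scalerA.
by rewrite mulrC -normCK z1 expr1n scale1r.
Qed.

Let V := mkcmx continuous_unitary_val.

Lemma continuous_conj_rep (M : 'M[C]_n) :
  continuous (fun x : PU => rep x *m M *m (rep x)^t*).
Proof.
apply: continuous_PU.
rewrite (_ : _ \o _ = V * cmx_const _ M * cmx_star V); first exact: cts_fun.
apply/funext => u /=; have [z z1 ->] := rep_pu u.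
exact: conj_phase.
Qed.

Lemma continuous_conj_repV (M : 'M[C]_n) :
  continuous (fun x : PU => (rep x)^t* *m M *m rep x).
Proof.
apply: continuous_PU.
rewrite (_ : _ \o _ = cmx_star V * cmx_const _ M * V); first exact: cts_fun.
apply/funext => u /=; have [z z1 ->] := rep_pu u.
exact: conj_phaseV.
Qed.

Definition conj_rep := sandwich continuous_conj_rep.

Lemma conj_repE f x : conj_rep f x = rep x *m f x *m (rep x)^t*.
Proof. exact: sandwichE. Qed.

Lemma conj_rep_automorphism : star_automorphism conj_rep.
Proof.
have repV x := unitary_mulVmx (rep_unitary x).
have repK x := unitarymxP (rep_unitary x).
split.
- exists (sandwich continuous_conj_repV) => f; apply: cmxP => x;
    rewrite ?conj_repE sandwichE ?conj_repE ?sandwichE !mulmxA.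
    by rewrite repV mul1mx -mulmxA repV mulmx1.
  by rewrite repK mul1mx -mulmxA repK mulmx1.
- move=> a f g; apply: cmxP => x.
  rewrite conj_repE !cmxDE !cmxZE !conj_repE mulmxDr mulmxDl.
  by rewrite -scalemxAr -scalemxAl.
- split; first by apply: cmxP => x; rewrite conj_repE !cmx1E mulmx1 repK.
  move=> f g; apply: cmxP => x; rewrite cmxME !conj_repE cmxME.
  by rewrite !mulmxA -(mulmxA _ ((rep x)^t*) (rep x)) repV mulmx1.
move=> f; apply: cmxP => x; rewrite conj_repE.
rewrite [RHS](_ : _ = (conj_rep f x)^t*)// conj_repE.
by rewrite !adjmxM adjmxK mulmxA.
Qed.

(** If [a] implements the automorphism then [a] and [u] induce the same
    conjugation, so they differ by a scalar [l u].  Since [a] depends on the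
    class of [u] only, [l] has to compensate the phase of [u]. *)
Lemma inner_conj_rep_phase (i0 : 'I_n) : inner_automorphism conj_rep ->
  exists l : U -> C, [/\ continuous l, forall u, l u != 0
   & forall z u v, `|z| = 1 -> \val v = z *: \val u -> l v = z^-1 * l u].
Proof.
move=> [a [b [ab ba conjE]]].
have abx x : a x *m b x = 1%:M by rewrite -cmxME ab.
have bax x : b x *m a x = 1%:M by rewrite -cmxME ba.
pose S u := (\val u)^t* *m a (pu u).
have S_scalar u : S u = (S u i0 i0)%:M.
  apply: mx_commutant => M.
  have uVu := unitary_mulVmx (val_unitary u).
  have : \val u *m M *m (\val u)^t* = a (pu u) *m M *m b (pu u).
    have := congr1 (fun f : A => f (pu u)) (conjE (cmx_const _ M)).
    rewrite conj_repE !cmxME cmx_constE => <-.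
    by have [z z1 ->] := rep_pu u; rewrite conj_phase.
  move=> /(congr1 (fun T => (\val u)^t* *m T *m a (pu u))) /=.
  by rewrite !mulmxA uVu mul1mx -(mulmxA _ (b _)) bax mulmx1 /S => <-.
have ca : continuous (fun u : U => a (pu u)).
  move=> u; apply: continuous_comp; first exact: continuous_pu.
  exact: cts_fun.
exists (fun u => S u i0 i0); split.
- exact: (continuous_entry (f := cmx_star V * mkcmx ca)).
- move=> u; apply/eqP => Su0; have := S_scalar u; rewrite Su0.
  move=> /(congr1 (fun T => \val u *m T *m b (pu u))) /=.
  rewrite /S !mulmxA (unitarymxP (val_unitary u)) mul1mx abx.
  rewrite mul_mx_scalar scale0r mul0mx => /matrixP /(_ i0 i0).
  by rewrite !mxE eqxx => /eqP; rewrite oner_eq0.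
move=> z u v z1 vu; rewrite /S.
have -> : pu v = pu u.
  by apply/esym/eqmodP/asboolP; exists z.
rewrite vu adjmxZ -scalemxAl mxE; congr (_ * _).
by rewrite invC_norm z1 expr1n invr1 mul1r.
Qed.

End RepresentativeConjugation.

(** * Real coordinates and principal arguments of complex numbers *)

Section ComplexTopology.
Variables (R : realType) (T : Type) (F : set_system T).
Context {FF : Filter F}.
Local Notation C := (R[i] : numClosedFieldType).
Local Open Scope complex_scope.

Lemma cvg_Re (f : T -> C) (l : C) : f @ F --> l ->
  (fun x => complex.Re (f x)) @ F --> complex.Re l.
Proof.
move=> /(@cvgrPdist_lt _ C^o) fl; apply/(@cvgrPdist_lt _ R^o) => e e0.
have eC0 : 0 < e%:C by rewrite ltcR.
apply: filterS (fl _ eC0) => x; rewrite -ltcR -raddfB => h.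
apply: le_lt_trans h; exact: normc_ge_Re.
Qed.

Lemma cvg_real_complex (f : T -> R) (l : R) : f @ F --> l ->
  (fun x => (f x)%:C : C) @ F --> (l%:C : C).
Proof.
move=> /(@cvgrPdist_lt _ R^o) fl; apply/(@cvgrPdist_lt _ C^o) => e.
rewrite ltcE /= => /andP[/eqP Ime Ree].
apply: filterS (fl _ Ree) => x h.
rewrite -rmorphB /= normc_def /= expr0n addr0 sqrtr_sqr ltcE /= h.
by rewrite Ime eqxx.
Qed.

Lemma cvg_Im (f : T -> C) (l : C) : f @ F --> l ->
  (fun x => complex.Im (f x)) @ F --> complex.Im l.
Proof.
move=> fl; have -> : complex.Im l = - complex.Re (l * 'i%C).
  by rewrite ReiNIm opprK.
under eq_fun do rewrite -[complex.Im _]opprK -ReiNIm.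
by apply: cvgN; apply: cvg_Re; apply: cvgM; [exact: fl|exact: cvg_cst].
Qed.

End ComplexTopology.

Section Argument.
Variable R : realType.
Local Notation C := (R[i] : numClosedFieldType).
Implicit Types (x y : R) (w : C).
Local Open Scope complex_scope.

Definition cis x : C := cos x +i* sin x.

Lemma cisD x y : cis (x + y) = cis x * cis y.
Proof.
by rewrite /cis cosD sinD; apply/eqP; rewrite eq_complex /= !eqxx /= addrC.
Qed.

Lemma cis0 : cis 0 = 1.
Proof. by rewrite /cis cos0 sin0. Qed.

Lemma cis_neq0 x : cis x != 0.
Proof.
apply/eqP => x0; have := cisD x (- x).
by rewrite subrr cis0 x0 mul0r => /eqP; rewrite oner_eq0.
Qed.

Lemma cisV x : (cis x)^-1 = cis (- x).
Proof.
by apply: (mulfI (cis_neq0 x)); rewrite -cisD subrr cis0 divff ?cis_neq0.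
Qed.

Lemma norm_cis x : `|cis x| = 1.
Proof. by rewrite normc_def /= cos2Dsin2 sqrtr1. Qed.

Lemma cis2pi : cis (2 * pi) = 1.
Proof. by rewrite mulrC mulr_natr /cis cos2pi sin2pi. Qed.

Lemma cisX x m : cis x ^+ m = cis (x *+ m).
Proof.
elim: m => [|m IH]; first by rewrite expr0 mulr0n cis0.
by rewrite exprS IH mulrS cisD.
Qed.

Lemma cis_neq1 x : 0 < x <= pi -> cis x != 1.
Proof.
move=> /andP[x0 xpi]; rewrite eq_complex /= negb_and; apply/orP; left.
apply/eqP => cx; have : x = 0.
  apply: cos_inj; rewrite ?in_itv/= ?lexx ?pi_ge0 ?(ltW x0)//.
  by rewrite cos0.
by move=> x00; rewrite x00 ltxx in x0.
Qed.

Lemma continuous_cis : continuous (cis : R -> C).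
Proof.
move=> x; rewrite (_ : cis = fun y => (cos y)%:C + 'i%C * (sin y)%:C : C).
  apply: cvgD; first by apply: cvg_real_complex; exact: continuous_cos.
  apply: cvgM; first exact: cvg_cst.
  by apply: cvg_real_complex; exact: continuous_sin.
apply/funext => y; rewrite [cis y]complexE; congr (_ + _ * _).
Qed.

(** By [cis_neq1] distinct solutions of [cis x = 1] differ by more than [pi],
    so a continuous function with values among them cannot move. *)
Lemma cis1_constant (f : R -> R) :
  (forall t, 0 <= t <= 1 -> {for t, continuous f}) ->
  (forall t, 0 <= t <= 1 -> cis (f t) = 1) -> f 0 = f 1.
Proof.
move=> cf f1; apply: contrapT => /eqP f01.
pose m := Num.min (f 0) (f 1); pose M := Num.max (f 0) (f 1).
have mM : m < M.
  rewrite /m /M; have [h|h|h] := ltgtP (f 0) (f 1) => //.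
  by rewrite h eqxx in f01.
(* A value of [f], by continuity, which exceeds the solution [m] by at most
   [pi], so that [cis v != 1]. *)
pose v := m + Num.min (M - m) pi.
have v0 : 0 < Num.min (M - m) pi by rewrite lt_min subr_gt0 mM pi_gt0.
have [c] : exists2 c, c \in `[0, 1]%R & f c = v.
  apply: IVT => //.
    by apply: continuous_in_subspaceT => t; rewrite inE/= in_itv/=; exact: cf.
  rewrite -/m -/M /v lerDl ltW//= addrC -lerBrDr ge_min lexx//.
rewrite in_itv/= => /f1 + fc; rewrite fc /v cisD.
have -> : cis m = 1.
  by rewrite /m; case: ltP => _; apply: f1; rewrite ?lexx ler01.
rewrite mul1r => /eqP; apply/negP; apply: cis_neq1.
by rewrite v0 ge_min lexx orbT.
Qed.

(** The principal argument, meant for the half-plane [0 < Re w]. *)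
Definition arg w : R := atan (complex.Im w / complex.Re w).

Lemma arg_cis x : - (pi / 2) < x < pi / 2 -> arg (cis x) = x.
Proof. by move=> x2; rewrite /arg /= -[_ / _]/(tan x) tanK// in_itv. Qed.

Lemma argK w : 0 < complex.Re w ->
  exists2 r : R, 0 < r & w = r%:C * cis (arg w).
Proof.
move=> w0; set a := arg w.
have ca : 0 < cos a by apply: cos_gt0_pihalf; rewrite atan_gtNpi2 atan_ltpi2.
have [ca0 rw0] := (lt0r_neq0 ca, lt0r_neq0 w0).
exists (complex.Re w / cos a); first by rewrite divr_gt0.
have /eqP : tan a = complex.Im w / complex.Re w by rewrite atanK.
rewrite /tan eqr_div// => /eqP saw.
apply/eqP; rewrite eq_complex /=; simpc.
by rewrite mulfVK// eqxx /= mulrAC [_ * sin a]mulrC saw mulfK.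
Qed.

(** When small increments multiply to [1], their arguments add up to an
    integral multiple of the full turn. *)
Lemma cis_sum_arg (r : seq nat) (w : nat -> C) :
  (forall k, k \in r -> 0 < complex.Re (w k)) ->
  \prod_(k <- r) w k = 1 -> cis (\sum_(k <- r) arg (w k)) = 1.
Proof.
move=> w0.
suff [s s0 ->] : exists2 s : R, 0 < s &
    \prod_(k <- r) w k = s%:C * cis (\sum_(k <- r) arg (w k)).
  move=> sE; have := congr1 (@Num.norm _ C) sE.
  rewrite normrM norm_cis mulr1 normr1 ger0_norm ?ler0c ?ltW// => s1.
  by rewrite s1 mul1r in sE.
elim: r w0 => [|k r IH] w0.
  by exists 1 => //; rewrite !big_nil cis0 mulr1.
have [|s s0 IHs] := IH; first by move=> j jr; apply: w0; rewrite inE jr orbT.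
have [|u u0 wk] := @argK (w k); first by apply: w0; rewrite inE eqxx.
exists (u * s); first exact: mulr_gt0.
by rewrite !big_cons IHs {1}wk cisD rmorphM /= mulrACA.
Qed.

Lemma cvg_arg (T : Type) (F : set_system T) {FF : Filter F}
    (f : T -> C) (l : C) :
  f @ F --> l -> 0 < complex.Re l -> (fun t => arg (f t)) @ F --> arg l.
Proof.
move=> fl l0.
apply: (@cvg_comp _ _ _ (fun t => complex.Im (f t) / complex.Re (f t)) atan).
  2: exact: continuous_atan.
apply: cvgM; first exact: cvg_Im.
by apply: cvgV; [rewrite gt_eqF|exact: cvg_Re].
Qed.

End Argument.

(** * Winding numbers *)

Lemma sum_periodic (V : nmodType) (n M : nat) (f : nat -> V) :
  (forall k, f (k + M)%N = f k) ->
  \sum_(0 <= k < n * M) f k = (\sum_(0 <= k < M) f k) *+ n.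
Proof.
move=> fM; elim: n => [|n IH]; first by rewrite mul0n big_geq// mulr0n.
rewrite mulSn (@big_cat_nat _ _ _ M)//= ?leq_addr// mulrS; congr (_ + _).
rewrite -[X in \sum_(X <= _ < _) _]add0n big_addn addKn -IH.
by apply: eq_bigr => k _.
Qed.

Section Winding.
Variable R : realType.
Local Notation C := (R[i] : numClosedFieldType).
Variable G : R * R -> C.
Hypothesis cG : continuous G.
Hypothesis G0 : forall p, G p != 0.

(** Uniform continuity on the unit square, in the form that controls the
    arguments of successive quotients. *)
Lemma small_increments : \forall N \near \oo, forall p : R * R,
  0 <= p.1 <= 1 -> 0 <= p.2 <= 1 ->
  0 < complex.Re (G (p.1 + N.+1%:R^-1, p.2) / G p).
Proof.
pose K : set (R * R) := `[0, 1]%classic `*` `[0, 1]%classic.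
have cK : compact K by apply: compact_setX; exact: segment_compact.
pose P (N : nat) (p : R * R) :=
  0 < complex.Re (G (p.1 + N.+1%:R^-1, p.2) / G p).
have KP : forall p, K p -> \forall q \near p & N \near \oo, P N q.
  move=> p _.
  pose FF := filter_prod (nbhs p) \oo.
  have fFF : Filter FF by exact: filter_prod_filter.
  have h1 : (fun z : (R * R) * nat => z.1) @ FF --> p by exact: cvg_fst.
  have h2 : (fun z : (R * R) * nat => z.2.+1%:R^-1 : R) @ FF --> (0 : R).
    apply: (@cvg_comp _ _ _ (fun z : (R * R) * nat => z.2) (@harmonic R)).
      exact: cvg_snd.
    exact: cvg_harmonic.
  have h3a : (fun z : (R * R) * nat => z.1.1 + z.2.+1%:R^-1) @ FF --> p.1.
    rewrite -[X in _ --> X]addr0; apply: cvgD; last exact: h2.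
    apply: (@cvg_comp _ _ _ (fun z : (R * R) * nat => z.1) fst _ _ _ h1).
    exact: cvg_fst.
  have h3b : (fun z : (R * R) * nat => z.1.2) @ FF --> p.2.
    apply: (@cvg_comp _ _ _ (fun z : (R * R) * nat => z.1) snd _ _ _ h1).
    exact: cvg_snd.
  have h3 : (fun z : (R * R) * nat => (z.1.1 + z.2.+1%:R^-1, z.1.2)) @ FF
      --> p.
    by case: (p) h3a h3b => s t h3a h3b; exact: cvg_pair h3a h3b.
  have h4 : (fun z : (R * R) * nat =>
      G (z.1.1 + z.2.+1%:R^-1, z.1.2) / G z.1) @ FF --> (1 : C).
    rewrite -(divff (G0 p)); apply: cvgM.
      exact: (@cvg_comp _ _ _ (fun z : (R * R) * nat =>
        (z.1.1 + z.2.+1%:R^-1, z.1.2)) G _ _ _ h3 (@cG p)).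
    apply: cvgV => //.
    exact: (@cvg_comp _ _ _ (fun z : (R * R) * nat => z.1) G _ _ _ h1 (@cG p)).
  have h5 := @cvg_Re _ _ _ fFF _ _ h4.
  exact: cvgr_gt h5 _ ltr01.
have fN : Filter (\oo : set_system nat) by exact: eventually_filter.
have := @iffLR _ _ (compact_near_coveringP K) cK nat \oo P fN KP.
apply: filterS => N KN p p1 p2.
by apply: KN; split; rewrite /= in_itv.
Qed.

(** A homotopy of loops in the punctured plane cannot join a loop that is
    [1 / n]-periodic, whose winding number is a multiple of [n], to a loop of
    winding number [-1]. *)
Lemma winding_obstruction (n : nat) : (2 <= n)%N ->
  (forall t, G (1, t) = G (0, t)) ->
  (forall s, G (s + n%:R^-1, 0) = G (s, 0)) ->
  (forall s, G (s, 1) = cis (- (2 * pi * s)) * G (0, 1)) -> False.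
Proof.
move=> n2 Gloop G_per G_lin.
have [N0 _ smallN] := small_increments.
(* A subdivision into [N] steps, where [N] is a multiple of [n] so that one
   period [1 / n] consists of [M] steps, and [4 < N] so that the angle of a
   step of the standard loop is below [pi / 2]. *)
pose M := (N0 + 5)%N; pose N := (n * M)%N.
have M0 : (0 < M)%N by rewrite /M addnS.
have n0 : (0 < n)%N := ltnW n2.
have MN : (M <= N)%N by rewrite leq_pmull.
have N_gt0 : (0 < N)%N := leq_trans M0 MN.
pose h : R := N%:R^-1.
have h0 : 0 < h by rewrite invr_gt0 ltr0n.
pose ratio k t : C := G (k%:R * h + h, t) / G (k%:R * h, t).
have ratioS k t : ratio k t = G (k.+1%:R * h, t) / G (k%:R * h, t).
  by rewrite /ratio -natr1 mulrDl mul1r.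
have ratio_gt0 k t : (k <= N)%N -> 0 <= t <= 1 -> 0 < complex.Re (ratio k t).
  move=> kN t01; have := smallN N.-1 _ (k%:R * h, t).
  rewrite /= prednK//; apply => //.
    by rewrite -ltnS prednK// (leq_trans _ MN)// /M addnS ltnS leq_addr.
  by rewrite mulr_ge0 ?ler0n ?(ltW h0)//= /h ler_pdivrMr ?ltr0n// mul1r ler_nat.
have prod_ratio m t : (0 < m)%N ->
    \prod_(0 <= k < m) ratio k t = G (m%:R * h, t) / G (0, t).
  move=> m0; rewrite (@telescope_prodf_eq _ _ _ (fun k => G (k%:R * h, t)))//.
  by rewrite mul0r.
(* [2 pi] times the winding number of the loop [s |-> G (s, t)]. *)
pose W t := \sum_(0 <= k < N) arg (ratio k t).
have cisW t : 0 <= t <= 1 -> cis (W t) = 1.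
  move=> t01; apply: cis_sum_arg.
    by move=> k; rewrite mem_index_iota => /andP[_ /ltnW kN]; exact: ratio_gt0.
  by rewrite prod_ratio// mulfV ?pnatr_eq0 -?lt0n// Gloop divff.
have cW t : 0 <= t <= 1 -> {for t, continuous W}.
  move=> t01.
  have slice s : (fun u => G (s, u)) @ t --> G (s, t).
    have st : (fun u => (s, u)) @ t --> (s, t).
      exact: (cvg_pair (cvg_cst s) cvg_id).
    exact: (@cvg_comp _ _ _ (fun u => (s, u)) G _ _ _ st (@cG (s, t))).
  have c_ratio k : (k <= N)%N ->
      (fun u => arg (ratio k u)) @ t --> arg (ratio k t).
    move=> kN; apply: cvg_arg; last exact: ratio_gt0.
    by apply: cvgM; [exact: slice|apply: cvgV; [exact: G0|exact: slice]].
  suff : forall r : seq nat, (forall k, k \in r -> (k <= N)%N) ->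
      (fun u => \sum_(k <- r) arg (ratio k u)) @ t
        --> \sum_(k <- r) arg (ratio k t).
    by apply => k; rewrite mem_index_iota => /andP[_ /ltnW].
  elim=> [|k r IH] kN.
    by under eq_fun do rewrite big_nil; rewrite big_nil; exact: cvg_cst.
  under eq_fun do rewrite big_cons; rewrite big_cons.
  apply: cvgD; first by apply: c_ratio; apply: kN; rewrite inE eqxx.
  by apply: IH => j jr; apply: kN; rewrite inE jr orbT.
have W1 : W 1 = - (2 * pi).
  have h4 : h < 4^-1.
    rewrite ltf_pV2 ?posrE ?ltr0n// ltr_nat (leq_trans _ MN)// /M.
    by rewrite addnS ltnS leq_addl.
  have pih : 0 < pi * h < pi / 4.
    by rewrite mulr_gt0 ?pi_gt0// ltr_pM2l ?pi_gt0.
  rewrite /W (eq_bigr (fun=> - (2 * pi * h))) => [|k _]; last first.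
    rewrite /ratio G_lin [X in _ / X]G_lin -mulf_div divff// mulr1 cisV -cisD.
    rewrite (_ : _ + _ = - (2 * pi * h)); last by ring.
    by apply: arg_cis; move: pih => /andP[]; lra.
  rewrite sumr_const_nat subn0 mulNrn -[_ *+ N]mulr_natr -mulrA /h.
  rewrite mulVf ?mulr1//.
  by rewrite pnatr_eq0 -lt0n.
(* The change of argument over one period at [t = 0]; the end point of the
   period equals its starting point, so [cis S = 1]. *)
pose S := \sum_(0 <= k < M) arg (ratio k 0).
have Mh : M%:R * h = n%:R^-1.
  by rewrite /h /N natrM invfM mulrCA mulfV ?mulr1// pnatr_eq0 -lt0n.
have W0 : W 0 = S *+ n.
  rewrite /W /N sum_periodic// => k; congr arg.
  rewrite /ratio natrD mulrDl Mh G_per.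
  congr (_ / _); rewrite -(G_per (k%:R * h + h)); congr (G (_, _)).
  by rewrite addrAC.
have cisS : cis S = 1.
  apply: cis_sum_arg => [k|].
    rewrite mem_index_iota => /andP[_ /ltnW kM].
    by apply: ratio_gt0; rewrite ?(leq_trans kM MN)// lexx ler01.
  by rewrite prod_ratio// Mh -[n%:R^-1]add0r G_per divff.
(* Now [S] would be [- 2 pi / n], a proper fraction of a turn as [n >= 2]. *)
have /(congr1 (fun x => - x)) : S *+ n = - (2 * pi).
  by rewrite -W0 -W1; exact: cis1_constant.
rewrite opprK -mulNrn => Sn.
have SE : - S = 2 * pi / n%:R.
  by rewrite -Sn -[_ *+ n]mulr_natr mulfK// pnatr_eq0 -lt0n.
have /eqP := cisV S; rewrite cisS invr1 eq_sym SE; apply/negP/cis_neq1.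
rewrite divr_gt0 ?mulr_gt0 ?pi_gt0 ?ltr0n//= ler_pdivrMr ?ltr0n//.
by rewrite mulrC ler_pM2l ?pi_gt0// ler_nat.
Qed.

End Winding.

(** * A homotopy of loops in the unitary group *)

Section RankOneUnitaries.
Variables (C : numClosedFieldType) (n : nat).
Implicit Types (z w : C) (P : 'M[C]_n).
Local Open Scope sesquilinear_scope.

(** For an orthogonal projection [P] and [z] of norm [1], this is
    the complex reflection multiplying the range of [P] by [z]. *)
Definition reflection z P : 'M[C]_n := 1%:M + (z - 1) *: P.

Lemma reflectionM z w P : P *m P = P ->
  reflection z P *m reflection w P = reflection (z * w) P.
Proof.
move=> PP; rewrite /reflection mulmxDl !mulmxDr !mulmx1 mul1mx -!scalemxAl.
rewrite -scalemxAr PP scalerA -!addrA; congr (_ + _).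
by rewrite -!scalerDl; congr (_ *: _); ring.
Qed.

Lemma reflection1 P : reflection 1 P = 1%:M.
Proof. by rewrite /reflection subrr scale0r addr0. Qed.

Lemma reflectionX z P m : P *m P = P ->
  reflection z P ^+ m = reflection (z ^+ m) P.
Proof.
move=> PP; elim: m => [|m IH]; first by rewrite !expr0 reflection1.
by rewrite !exprS IH -mulmxE reflectionM.
Qed.

Lemma reflection_unitary z P : `|z| = 1 -> P *m P = P -> P^t* = P ->
  reflection z P \is unitarymx.
Proof.
move=> z1 PP PA; apply/unitarymxP.
have -> : (reflection z P)^t* = reflection z^* P.
  rewrite /reflection -{2}PA; apply/matrixP => i j; rewrite !mxE.
  by rewrite rmorphD rmorphM rmorphB rmorph1 rmorph_nat eq_sym.
by rewrite reflectionM// -normCK z1 expr1n reflection1.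
Qed.

Lemma prod_reflection_delta z (r : seq 'I_n) : uniq r ->
  \prod_(k <- r) reflection z (delta_mx k k) =
  1%:M + (z - 1) *: \sum_(k <- r) delta_mx k k.
Proof.
elim: r => [|k r IH] /=; first by rewrite !big_nil scaler0 addr0.
move=> /andP[kr ur].
have dk0 : delta_mx k k *m \sum_(j <- r) delta_mx j j = 0 :> 'M[C]_n.
  rewrite mulmx_sumr big_seq big1// => j jr; rewrite mul_delta_mx_0//.
  by apply: contraNneq kr => ->.
rewrite !big_cons IH// /reflection -mulmxE.
rewrite mulmxDl !mulmxDr !mulmx1 mul1mx -!scalemxAl -scalemxAr dk0.
by rewrite !scaler0 addr0 scalerDr -addrA; congr (_ + _); rewrite addrC.
Qed.

Lemma prod_reflection_all z :
  \prod_(k : 'I_n) reflection z (delta_mx k k) = z%:M.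
Proof.
rewrite prod_reflection_delta ?index_enum_uniq//.
have -> : \sum_(k : 'I_n) delta_mx k k = 1%:M :> 'M[C]_n.
  rewrite [RHS]matrix_sum_delta; apply: eq_bigr => i _.
  rewrite (bigD1 i)//= big1 => [|j ji]; first by rewrite mxE eqxx scale1r addr0.
  by rewrite mxE eq_sym (negPf ji) scale0r.
by rewrite scalemx1 -raddfD /= addrC subrK.
Qed.

End RankOneUnitaries.

Section LoopHomotopy.
Variables (R : realType) (n : nat) (i0 : 'I_n).
Local Notation C := (R[i] : numClosedFieldType).
Local Open Scope complex_scope.
Local Open Scope sesquilinear_scope.

(** A path of unit vectors, turning from the basis vector [i0] to the basis
    vector [k] in the plane that they span. *)
Definition axis (k : 'I_n) (t : R) (i : 'I_n) : R :=
  if k == i0 then (i == i0)%:R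
  else (i == i0)%:R * cos (pi / 2 * t) + (i == k)%:R * sin (pi / 2 * t).

Definition axis_proj k t : 'M[C]_n :=
  \matrix_(i, j) (axis k t i * axis k t j)%:C.

Lemma axis_norm k t : \sum_i axis k t i ^+ 2 = 1.
Proof.
rewrite /axis; case: eqVneq => [_|ki0].
  rewrite (bigD1 i0)//= eqxx expr1n big1 ?addr0// => i ii0.
  by rewrite (negPf ii0) expr0n.
rewrite (bigD1 i0)//= (bigD1 k)//= !eqxx (negPf ki0) eq_sym (negPf ki0).
rewrite big1 => [|i /andP[/negPf-> /negPf->]].
  by rewrite !mul0r !mul1r addr0 add0r addr0 cos2Dsin2.
by rewrite !mul0r addr0 expr0n.
Qed.

Lemma axis_proj_idem k t : axis_proj k t *m axis_proj k t = axis_proj k t.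
Proof.
apply/matrixP => i j; rewrite !mxE.
transitivity (\sum_l ((axis k t i * axis k t j) * axis k t l ^+ 2)%:C).
  by apply: eq_bigr => l _; rewrite !mxE -rmorphM; congr (_%:C); ring.
by rewrite -rmorph_sum -mulr_sumr axis_norm mulr1.
Qed.

Lemma axis_proj_adj k t : (axis_proj k t)^t* = axis_proj k t.
Proof.
apply/matrixP => i j; rewrite !mxE mulrC.
exact: conjc_real.
Qed.

Lemma axis_proj0 k : axis_proj k 0 = delta_mx i0 i0.
Proof.
have a0 i : axis k 0 i = (i == i0)%:R.
  by rewrite /axis mulr0 cos0 sin0 mulr1 mulr0 addr0 if_same.
apply/matrixP => i j; rewrite !mxE !a0 -natrM mulnb.
by case: andP.
Qed.

Lemma axis_proj1 k : axis_proj k 1 = delta_mx k k.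
Proof.
have a1 i : axis k 1 i = (i == k)%:R.
  rewrite /axis mulr1 cos_pihalf sin_pihalf mulr1 mulr0 add0r.
  by case: eqVneq => [->|].
apply/matrixP => i j; rewrite !mxE !a1 -natrM mulnb.
by case: andP.
Qed.

(** A homotopy with parameter [p.2] of the loops [p.1 |-> loop_homotopy p]:
    at [p.2 = 0] all axes agree and the loop is an [n]-th power, at [p.2 = 1]
    they form the standard basis and the loop is scalar. *)
Definition loop_homotopy (p : R * R) : 'M[C]_n :=
  \prod_k reflection (cis (2 * pi * p.1)) (axis_proj k p.2).

Lemma loop_homotopy_unitary p : loop_homotopy p \is unitarymx.
Proof.
rewrite /loop_homotopy; apply: (big_ind (fun u => u \is unitarymx)).
- by apply/unitarymxP; rewrite mul1mx trmx1 map_mx1.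
- by move=> u v uU vU; rewrite -mulmxE mul_unitarymx.
move=> k _; apply: reflection_unitary; first exact: norm_cis.
  exact: axis_proj_idem.
exact: axis_proj_adj.
Qed.

Lemma continuous_loop_homotopy : continuous loop_homotopy.
Proof.
have cd k : continuous (fun p : R * R =>
    reflection (cis (2 * pi * p.1)) (axis_proj k p.2)).
  apply: continuous_entries => i j p.
  rewrite (_ : (fun q => _) = (fun q : R * R => (i == j)%:R +
      (cis (2 * pi * q.1) - 1) * (axis k q.2 i * axis k q.2 j)%:C : C)).
    2: by apply/funext => q; rewrite !mxE.
  have c_phase : (fun q : R * R => cis (2 * pi * q.1)) @ p
      --> cis (2 * pi * p.1).
    have c2pi : (fun q : R * R => 2 * pi * q.1) @ p --> 2 * pi * p.1.
      by apply: cvgM; [exact: cvg_cst|exact: cvg_fst].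
    exact: (@cvg_comp _ _ _ (fun q : R * R => 2 * pi * q.1) _ _ _ _ c2pi
      (@continuous_cis R _)).
  have c_axis l : (fun q : R * R => axis k q.2 l) @ p --> axis k p.2 l.
    rewrite /axis; case: ifP => _; first exact: cvg_cst.
    have ct : (fun q : R * R => pi / 2 * q.2) @ p --> pi / 2 * p.2.
      by apply: cvgM; [exact: cvg_cst|exact: cvg_snd].
    apply: cvgD; apply: cvgM; try exact: cvg_cst.
      exact: (@cvg_comp _ _ _ (fun q : R * R => pi / 2 * q.2) _ _ _ _ ct
        (@continuous_cos R _)).
    exact: (@cvg_comp _ _ _ (fun q : R * R => pi / 2 * q.2) _ _ _ _ ct
      (@continuous_sin R _)).
  have c_entry : (fun q : R * R => (axis k q.2 i * axis k q.2 j)%:C : C) @ p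
      --> ((axis k p.2 i * axis k p.2 j)%:C : C).
    by apply: cvg_real_complex; apply: cvgM; exact: c_axis.
  have c_sub : (fun q : R * R => cis (2 * pi * q.1) - 1) @ p
      --> (cis (2 * pi * p.1) - 1).
    have Fp : Filter (nbhs p) by exact: nbhs_filter.
    exact: (@cvgB C C^o _ _ Fp _ _ _ _ c_phase (cvg_cst _)).
  have c_prod : (fun q : R * R => (cis (2 * pi * q.1) - 1) *
        (axis k q.2 i * axis k q.2 j)%:C : C) @ p
      --> ((cis (2 * pi * p.1) - 1) *
        (axis k p.2 i * axis k p.2 j)%:C : C).
    by apply: cvgM; [exact: c_sub|exact: c_entry].
  by apply: cvgD; [exact: cvg_cst|exact: c_prod].
pose f : cmx (R * R)%type R[i] n := \prod_k mkcmx (cd k).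
suff -> : loop_homotopy = f by exact: cts_fun.
apply/funext => p; rewrite /loop_homotopy /f; elim/big_rec2: _ => // k u g _ ->.
by rewrite cmxME mulmxE.
Qed.

Definition loop_homotopy_group p : unitary_group C n :=
  exist _ (loop_homotopy p)
    (mem_set (loop_homotopy_unitary p : unitary_group R[i] n _)).

Lemma continuous_loop_homotopy_group : continuous loop_homotopy_group.
Proof. by apply: continuous_comp_initial; exact: continuous_loop_homotopy. Qed.

End LoopHomotopy.

(** For such an [l] the matrix [l u *: u] would depend on the class of [u]
    only: a section, up to nonzero scalars, of the quotient map from [U(n)] to
    [PU(n)].  Composed with the homotopy, [l] contradicts
    [winding_obstruction]. *)
Lemma no_continuous_phase (R : realType) (n : nat)
    (l : unitary_group R[i] n -> (R[i] : numClosedFieldType)) :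
  (2 <= n)%N -> continuous l -> (forall u, l u != 0) ->
  (forall z u v, `|z| = 1 -> \val v = z *: \val u -> l v = z^-1 * l u) ->
  False.
Proof.
move=> n_ge2 cl l0 lz.
have n0 : (0 < n)%N := ltnW n_ge2.
pose i0 : 'I_n := Ordinal n0.
pose G p := l (loop_homotopy_group i0 p).
have GE p q : loop_homotopy i0 p = loop_homotopy i0 q -> G p = G q.
  by move=> pq; congr l; apply: val_inj.
apply: (@winding_obstruction R G _ _ n n_ge2).
- move=> p; apply: continuous_comp; last exact: cl.
  exact: continuous_loop_homotopy_group.
- by move=> p; exact: l0.
- by move=> t; apply: GE; rewrite /loop_homotopy /= mulr1 cis2pi mulr0 cis0.
- have loop_homotopy0 s : loop_homotopy i0 (s, 0) =
      reflection (cis (2 * pi * s) ^+ n) (delta_mx i0 i0).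
    rewrite /loop_homotopy /=; under eq_bigr do rewrite axis_proj0.
    by rewrite prodr_const card_ord reflectionX// mul_delta_mx.
  have root_n : cis (2 * pi / n%:R) ^+ n = 1 :> (R[i] : numClosedFieldType).
    have n_neq0 : n%:R != 0 :> R by rewrite pnatr_eq0 -lt0n.
    by rewrite cisX -[_ *+ n]mulr_natr mulfVK// cis2pi.
  move=> s; apply: GE; rewrite !loop_homotopy0.
  by rewrite (mulrDr (2 * pi) s) cisD exprMn root_n mulr1.
move=> s; rewrite -cisV; apply: lz; first exact: norm_cis.
have loop_homotopy1 (r : R) : loop_homotopy i0 (r, 1) = (cis (2 * pi * r))%:M.
  rewrite /loop_homotopy /=; under eq_bigr do rewrite axis_proj1.
  exact: prod_reflection_all.
change (loop_homotopy i0 (s, 1) = cis (2 * pi * s) *: loop_homotopy i0 (0, 1)).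
rewrite !loop_homotopy1.
by rewrite mulr0 cis0 scalemx1.
Qed.

Local Open Scope complex_scope.

Theorem proposition4p2 (R : realType) (n : nat) (n_ge2 : (2 <= n)%N) :
  let A := cmx (PU R[i] n) R[i] n in
  (forall delta : A -> A, derivation delta -> inner_derivation delta) /\
  (exists phi : A -> A,
     [/\ star_automorphism phi, ~ inner_automorphism phi
       & elementary_operator phi]).
Proof.
pose i0 : 'I_n := Ordinal (ltnW n_ge2).
move=> A; split; first by move=> delta dd; exact: derivation_inner dd i0.
exists (@conj_rep _ _); split.
- exact: conj_rep_automorphism.
- move=> /(inner_conj_rep_phase i0)[l [cl l0 lz]].
  apply: (@no_continuous_phase R n l n_ge2); [exact: cl|exact: l0|exact: lz].
exact: sandwich_elementary.
Qed.
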